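(* Let $k$ be a field of characteristic $5$. For any integer $n>1$, the group algebras $kC_5$ and $kC_{5^n}$ are not separably equivalent.
   Context: $C_r$ denotes the cyclic group of order $r$. Two finite dimensional $k$-algebras $A$ and $B$ are separably equivalent if there are bimodules ${}_AM_B$ and ${}_BN_A$ (with $k$ acting centrally), each finitely generated and projective as a left module and as a right module, together with bimodules ${}_AX_A$, ${}_BY_B$ and bimodule isomorphisms $M\otimes_B N\cong A\oplus X$ and $N\otimes_A M\cong B\oplus Y$. *)

(* Defs.v *)
From HB Require Import structures.
From mathcomp Require Import all_boot all_order all_fingroup all_solvable.
From mathcomp Require Import all_algebra all_field.
From mathcomp Require Import generic_quotient boolp.
From mathcomp.multinomials Require Import freeg.

Set Implicit Arguments.
Unset Strict Implicit.
Unset Printing Implicit Defensive.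

Import GRing.Theory.
Local Open Scope ring_scope.
Local Open Scope quotient_scope.

Section FinProj.
Variables (R : nzRingType) (V : lmodType R).

Definition fin_generated : Prop :=
  exists n (e : 'I_n -> V), forall v, exists c : 'I_n -> R,
    v = \sum_(i < n) c i *: e i.

Definition projective : Prop :=
  forall (P Q : lmodType R) (p : {linear P -> Q}) (f : {linear V -> Q}),
    (forall y, exists x, p x = y) ->
    exists h : {linear V -> P}, forall v, p (h v) = f v.

Definition fg_projective : Prop := fin_generated /\ projective.

End FinProj.

Record bimodule (k : fieldType) (A B : algType k) := Bimodule {
  bimod_sort :> zmodType;
  lscale : A -> bimod_sort -> bimod_sort;
  rscale : bimod_sort -> B -> bimod_sort;
  lscale1 : forall m, lscale 1 m = m;
  lscaleM : forall a a' m, lscale (a * a') m = lscale a (lscale a' m);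
  lscaleDl : forall a a' m, lscale (a + a') m = lscale a m + lscale a' m;
  lscaleDr : forall a m m', lscale a (m + m') = lscale a m + lscale a m';
  rscale1 : forall m, rscale m 1 = m;
  rscaleM : forall m b b', rscale m (b * b') = rscale (rscale m b) b';
  rscaleDr : forall m b b', rscale m (b + b') = rscale m b + rscale m b';
  rscaleDl : forall m m' b, rscale (m + m') b = rscale m b + rscale m' b;
  lrscale : forall a m b, lscale a (rscale m b) = rscale (lscale a m) b;
  bimod_central : forall (c : k) m, lscale c%:A m = rscale m c%:A
}.

Section OneSided.
Variables (k : fieldType) (A B : algType k) (M : bimodule A B).

Definition left_module : Type := M.

HB.instance Definition _ := GRing.Zmodule.on left_module.

Fact left_scaleA a a' (m : left_module) :
  lscale a (lscale a' m) = lscale (a * a') m.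
Proof. by rewrite lscaleM. Qed.

HB.instance Definition _ := @GRing.Zmodule_isLmodule.Build A left_module
  (@lscale k A B M) left_scaleA (@lscale1 k A B M) (@lscaleDr k A B M)
  (fun m a a' => @lscaleDl k A B M a a' m).

(* A right B-module is a left module over the converse ring B^c. *)
Definition right_module : Type := M.

HB.instance Definition _ := GRing.Zmodule.on right_module.

Definition right_scale (b : B^c) (m : right_module) : right_module := rscale m b.

Fact right_scaleA b b' m :
  right_scale b (right_scale b' m) = right_scale (b * b') m.
Proof. by rewrite /right_scale -rscaleM. Qed.

Fact right_scale1 : left_id 1 right_scale.
Proof. exact: rscale1. Qed.

Fact right_scaleDr : right_distributive right_scale +%R.
Proof. by move=> b m m'; apply: rscaleDl. Qed.

Fact right_scaleDl m : {morph right_scale^~ m : b b' / b + b'}.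
Proof. by move=> b b'; apply: rscaleDr. Qed.

HB.instance Definition _ := GRing.Zmodule_isLmodule.Build B^c right_module
  right_scaleA right_scale1 right_scaleDr right_scaleDl.

End OneSided.

Definition bimod_iso (k : fieldType) (A B : algType k) (M N : bimodule A B)
    : Prop :=
  exists f : {additive M -> N},
    [/\ bijective f,
        forall a m, f (lscale a m) = lscale a (f m)
      & forall m b, f (rscale m b) = rscale (f m) b].

Section Regular.
Variables (k : fieldType) (A : algType k).

Fact regular_central (c : k) (x : A) : c%:A * x = x * c%:A.
Proof. by rewrite mulr_algl mulr_algr. Qed.

Definition regular_bimod : bimodule A A :=
  @Bimodule k A A A *%R *%R (@mul1r A) (fun a a' m => esym (mulrA a a' m))
    (@mulrDl A) (@mulrDr A) (@mulr1 A) (@mulrA A) (@mulrDr A) (@mulrDl A)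
    (@mulrA A) regular_central.

End Regular.

Section DirectSum.
Variables (k : fieldType) (A B : algType k) (M N : bimodule A B).

Let lscaleS (a : A) (p : M * N) : M * N := (lscale a p.1, lscale a p.2).
Let rscaleS (p : M * N) (b : B) : M * N := (rscale p.1 b, rscale p.2 b).

Definition dsum_bimod : bimodule A B.
Proof.
apply: (@Bimodule k A B (M * N)%type lscaleS rscaleS).
- by case=> m n; rewrite /lscaleS !lscale1.
- by move=> a a' [m n]; rewrite /lscaleS !lscaleM.
- by move=> a a' [m n]; rewrite /lscaleS !lscaleDl.
- by move=> a [m n] [m' n']; rewrite /lscaleS !lscaleDr.
- by case=> m n; rewrite /rscaleS !rscale1.
- by move=> [m n] b b'; rewrite /rscaleS !rscaleM.
- by move=> [m n] b b'; rewrite /rscaleS !rscaleDr.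
- by move=> [m n] [m' n'] b; rewrite /rscaleS !rscaleDl.
- by move=> a [m n] b; rewrite /lscaleS /rscaleS !lrscale.
- by move=> c [m n]; rewrite /lscaleS /rscaleS !bimod_central.
Defined.

End DirectSum.

Section GeneratedSubgroup.
Variables (V : zmodType) (S : V -> Prop).

Inductive in_zspan : V -> Prop :=
| Gen0 : in_zspan 0
| GenB x y : in_zspan x -> in_zspan y -> in_zspan (x - y)
| GenS x : S x -> in_zspan x.

Definition gen_pred (x : V) : bool := `[< in_zspan x >].

Fact gen_pred_closed : zmod_closed gen_pred.
Proof.
split=> [|x y /asboolP gx /asboolP gy]; apply/asboolP; [exact: Gen0|exact: GenB].
Qed.

HB.instance Definition _ := GRing.isZmodClosed.Build V gen_pred gen_pred_closed.

End GeneratedSubgroup.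

Section FreeAbelian.
Variables (K : choiceType) (V : zmodType).

Local Notation F := {freeg K / int}.

Lemma freeg_ind (P : F -> Prop) :
  P 0 -> (forall x y, P x -> P y -> P (x - y)) -> (forall z : K, P << z >>) ->
  forall x, P x.
Proof.
move=> P0 PB PU x; rewrite -[x]freeg_sumE.
have PN y : P y -> P (- y) by move=> Py; rewrite -sub0r; apply: PB.
have PD y z : P y -> P z -> P (y + z).
  by move=> Py Pz; rewrite -[z]opprK; apply: PB => //; apply: PN.
apply: big_ind => // z _; move: (coeff z x) => c.
have ->: << c *g z >> = << z >> *~ c :> F by rewrite freegU_mulz intz.
have Pn n : P (<< z >> *+ n) by elim: n => [|n IHn] //; rewrite mulrSr; apply: PD.
by case: c => n; [apply: Pn|rewrite NegzE mulrNz; apply: PN; apply: Pn].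
Qed.

Definition freeg_lift (f : K -> V) : F -> V := @fglift int (zmodule V) K f.

Fact freeg_liftB f : zmod_morphism (freeg_lift f).
Proof. exact: (@lift_is_additive int K (zmodule V) f). Qed.

HB.instance Definition _ f :=
  GRing.isZmodMorphism.Build F V (freeg_lift f) (freeg_liftB f).

Lemma freeg_liftU f z : freeg_lift f << z >> = f z.
Proof. by rewrite /freeg_lift liftU scale1r. Qed.

End FreeAbelian.

(* M (x)_B N is the free abelian group on M * N modulo the subgroup generated *)
(* by the relations making (m, n) |-> m (x) n biadditive and B-balanced.      *)
Section Tensor.
Variables (k : fieldType) (A B C : algType k).
Variables (M : bimodule A B) (N : bimodule B C).

Local Notation F := {freeg (M * N)%type / int}.
Local Notation gen m n := (<< ((m, n) : M * N) >> : F).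

Inductive tens_rel : F -> Prop :=
| TensDl m m' n : tens_rel (gen (m + m') n - gen m n - gen m' n)
| TensDr m n n' : tens_rel (gen m (n + n') - gen m n - gen m n')
| TensB m b n : tens_rel (gen (rscale m b) n - gen m (lscale b n)).

Definition tens_ker : zmodClosed F :=
  GRing.ZmodClosed.clone F (gen_pred tens_rel) _.

Local Notation tensor := (Quotient.quot tens_ker).

Definition tens (m : M) (n : N) : tensor := \pi_tensor (gen m n).

Local Notation piT := (\pi_tensor).

Fact piT_eq (x y : F) : in_zspan tens_rel (x - y) -> piT x = piT y.
Proof.
by move=> gxy; apply/eqP; rewrite -Quotient.idealrBE; apply/asboolP.
Qed.

Lemma tensDl m m' n : tens (m + m') n = tens m n + tens m' n.
Proof.
rewrite /tens -raddfD; apply: piT_eq; rewrite opprD addrA.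
exact/GenS/TensDl.
Qed.

Lemma tensDr m n n' : tens m (n + n') = tens m n + tens m n'.
Proof.
rewrite /tens -raddfD; apply: piT_eq; rewrite opprD addrA.
exact/GenS/TensDr.
Qed.

Lemma tens_balanced m b n : tens (rscale m b) n = tens m (lscale b n).
Proof. exact/piT_eq/GenS/TensB. Qed.

Lemma tensor_ind (P : tensor -> Prop) :
  P 0 -> (forall x y, P x -> P y -> P (x - y)) -> (forall m n, P (tens m n)) ->
  forall x, P x.
Proof.
move=> P0 PB PU x; rewrite -[x]reprK; move: (repr x) => {x}.
apply: freeg_ind => [|x y|[m n]]; [by rewrite raddf0| |exact: PU].
by rewrite raddfB; apply: PB.
Qed.

Section Universal.
Variables (V : zmodType) (f : M -> N -> V).

Definition balanced : Prop :=
  [/\ forall m m' n, f (m + m') n = f m n + f m' n,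
      forall m n n', f m (n + n') = f m n + f m n'
    & forall m b n, f (rscale m b) n = f m (lscale b n)].

Definition tens_lift (x : tensor) : V :=
  freeg_lift (fun p : M * N => f p.1 p.2) (repr x).

Hypothesis f_bal : balanced.

Local Notation f' := (freeg_lift (fun p : M * N => f p.1 p.2)).

Fact tens_lift_pi x : tens_lift (piT x) = f' x.
Proof.
have [fDl fDr fB] := f_bal.
have f'0 y : in_zspan tens_rel y -> f' y = 0.
  elim=> [|{}y z _ y0 _ z0|_ [m m' n|m n n'|m b n]]; rewrite ?raddf0 //.
  - by rewrite raddfB /= y0 z0 subr0.
  - by rewrite !raddfB /= !freeg_liftU /= fDl addrAC addrK subrr.
  - by rewrite !raddfB /= !freeg_liftU /= fDr addrAC addrK subrr.
  - by rewrite !raddfB /= !freeg_liftU /= fB subrr.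
apply/eqP; rewrite /tens_lift -subr_eq0 -raddfB; apply/eqP/f'0/asboolP.
by rewrite -[X in is_true X]/(_ \in tens_ker) Quotient.idealrBE reprK.
Qed.

Lemma tens_liftE m n : tens_lift (tens m n) = f m n.
Proof. by rewrite tens_lift_pi freeg_liftU. Qed.

Lemma tens_liftB : zmod_morphism tens_lift.
Proof.
move=> x y; rewrite -[x]reprK -[y]reprK -raddfB !tens_lift_pi.
exact: raddfB.
Qed.

End Universal.

Lemma tensor_ext (V : zmodType) (g h : tensor -> V) :
  zmod_morphism g -> zmod_morphism h ->
  (forall m n, g (tens m n) = h (tens m n)) -> g =1 h.
Proof.
move=> gB hB gh; apply: tensor_ind => [|x y ghx ghy|//].
  by rewrite -(subrr 0) gB hB !subrr.
by rewrite gB hB ghx ghy.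
Qed.

Definition tens_lscale (a : A) : tensor -> tensor :=
  tens_lift (fun m n => tens (lscale a m) n).

Definition tens_rscale (x : tensor) (c : C) : tensor :=
  tens_lift (fun m n => tens m (rscale n c)) x.

Fact tens_lscale_bal a : balanced (fun m n => tens (lscale a m) n).
Proof.
split=> [m m' n|m n n'|m b n]; first by rewrite lscaleDr tensDl.
- by rewrite tensDr.
- by rewrite lrscale tens_balanced.
Qed.

Fact tens_rscale_bal c : balanced (fun m n => tens m (rscale n c)).
Proof.
split=> [m m' n|m n n'|m b n]; first by rewrite tensDl.
- by rewrite rscaleDl tensDr.
- by rewrite tens_balanced lrscale.
Qed.

Lemma tens_lscaleE a m n : tens_lscale a (tens m n) = tens (lscale a m) n.
Proof. exact/tens_liftE/tens_lscale_bal. Qed.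

Lemma tens_rscaleE c m n : tens_rscale (tens m n) c = tens m (rscale n c).
Proof. exact/tens_liftE/tens_rscale_bal. Qed.

Fact tens_lscaleB a : zmod_morphism (tens_lscale a).
Proof. exact/tens_liftB/tens_lscale_bal. Qed.

Fact tens_rscaleB c : zmod_morphism (tens_rscale^~ c).
Proof. exact/tens_liftB/tens_rscale_bal. Qed.

Let zmod_morphD (g : tensor -> tensor) :
  zmod_morphism g -> {morph g : x y / x + y}.
Proof.
move=> gB x y; have g0 : g 0 = 0 by rewrite -(subrr 0) gB !subrr.
by rewrite -{1}[y]opprK gB -[- y]sub0r gB g0 sub0r opprK.
Qed.

Definition tensor_bimod : bimodule A C.
Proof.
apply: (@Bimodule k A C tensor tens_lscale tens_rscale).
- apply: tensor_ind => [|x y IHx IHy|m n].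
  + by rewrite -(subrr 0) tens_lscaleB !subrr.
  + by rewrite tens_lscaleB IHx IHy.
  + by rewrite tens_lscaleE lscale1.
- move=> a a'; apply: tensor_ind => [|x y IHx IHy|m n].
  + by rewrite -(subrr 0) !tens_lscaleB !subrr.
  + by rewrite !tens_lscaleB IHx IHy.
  + by rewrite !tens_lscaleE lscaleM.
- move=> a a'; apply: tensor_ind => [|x y IHx IHy|m n].
  + by rewrite -(subrr 0) !tens_lscaleB !subrr addr0.
  + by rewrite !tens_lscaleB IHx IHy opprD addrACA.
  + by rewrite !tens_lscaleE lscaleDl tensDl.
- by move=> a; apply/zmod_morphD/tens_lscaleB.
- apply: tensor_ind => [|x y IHx IHy|m n].
  + by rewrite -(subrr 0) tens_rscaleB !subrr.
  + by rewrite tens_rscaleB IHx IHy.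
  + by rewrite tens_rscaleE rscale1.
- move=> x c c'; move: x; apply: tensor_ind => [|x y IHx IHy|m n].
  + by rewrite -(subrr 0) !tens_rscaleB !subrr.
  + by rewrite !tens_rscaleB IHx IHy.
  + by rewrite !tens_rscaleE rscaleM.
- move=> x c c'; move: x; apply: tensor_ind => [|x y IHx IHy|m n].
  + by rewrite -(subrr 0) !tens_rscaleB !subrr addr0.
  + by rewrite !tens_rscaleB IHx IHy opprD addrACA.
  + by rewrite !tens_rscaleE rscaleDr tensDr.
- by move=> x y c; apply/(zmod_morphD (@tens_rscaleB c)).
- move=> a x c; move: x; apply: tensor_ind => [|x y IHx IHy|m n].
  + by rewrite -(subrr 0) !(tens_lscaleB, tens_rscaleB) !subrr.
  + by rewrite !(tens_lscaleB, tens_rscaleB) IHx IHy.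
  + by rewrite !(tens_lscaleE, tens_rscaleE).
- move=> c; apply: tensor_ind => [|x y IHx IHy|m n].
  + by rewrite -(subrr 0) !(tens_lscaleB, tens_rscaleB) !subrr.
  + by rewrite !(tens_lscaleB, tens_rscaleB) IHx IHy.
  + by rewrite tens_lscaleE tens_rscaleE bimod_central tens_balanced bimod_central.
Defined.

End Tensor.

Definition separably_equivalent (k : fieldType) (A B : falgType k) : Prop :=
  exists (M : bimodule A B) (N : bimodule B A),
    [/\ fg_projective (left_module M) /\ fg_projective (right_module M),
        fg_projective (left_module N) /\ fg_projective (right_module N),
        exists X : bimodule A A,
          bimod_iso (tensor_bimod M N) (dsum_bimod (regular_bimod A) X)
      & exists Y : bimodule B B,
          bimod_iso (tensor_bimod N M) (dsum_bimod (regular_bimod B) Y)].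

Section GroupAlgebra.
Variables (k : fieldType) (G : finGroupType).

(* The coefficients of \sum_g x(g) g. The ring structure MathComp puts on      *)
(* {ffun G -> k} is pointwise, so it must not be inherited.                    *)
Definition group_algebra : Type := {ffun G -> k^o}.

HB.instance Definition _ := Vector.on group_algebra.

Implicit Types x y z : group_algebra.

Definition galg_one : group_algebra := [ffun g => (g == 1%g)%:R].

Definition galg_mul x y : group_algebra :=
  [ffun g => \sum_(h : G) x h * y (h^-1 * g)%g].

Fact galg_mulA : associative galg_mul.
Proof.
move=> x y z; apply/ffunP=> g; rewrite !ffunE.
under eq_bigr do rewrite ffunE mulr_sumr.
under [RHS]eq_bigr do rewrite ffunE mulr_suml.
rewrite [RHS]exchange_big /=; apply: eq_bigr => h _.
rewrite [RHS](reindex_inj (mulgI h)) /=; apply: eq_bigr => u _.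
by rewrite mulrA mulKg invMg mulgA.
Qed.

Fact galg_mul1x : left_id galg_one galg_mul.
Proof.
move=> x; apply/ffunP=> g; rewrite ffunE (bigD1 1%g) //= ffunE eqxx mul1r.
rewrite invg1 mul1g big1 ?addr0 // => h /negPf h1.
by rewrite ffunE h1 mul0r.
Qed.

Fact galg_mulx1 : right_id galg_one galg_mul.
Proof.
move=> x; apply/ffunP=> g; rewrite ffunE (bigD1 g) //= ffunE mulVg eqxx mulr1.
rewrite big1 ?addr0 // => h hg; rewrite ffunE -eq_mulVg1 (negPf hg) mulr0 //.
Qed.

Fact galg_mulDl : left_distributive galg_mul +%R.
Proof.
move=> x y z; apply/ffunP=> g; rewrite !ffunE -big_split /=.
by apply: eq_bigr => h _; rewrite ffunE mulrDl.
Qed.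

Fact galg_mulDr : right_distributive galg_mul +%R.
Proof.
move=> x y z; apply/ffunP=> g; rewrite !ffunE -big_split /=.
by apply: eq_bigr => h _; rewrite ffunE mulrDr.
Qed.

Fact galg_one_neq0 : galg_one != 0.
Proof.
apply/eqP=> /ffunP/(_ 1%g); rewrite !ffunE eqxx => /eqP.
by rewrite oner_eq0.
Qed.

HB.instance Definition _ := GRing.Zmodule_isNzRing.Build group_algebra
  galg_mulA galg_mul1x galg_mulx1 galg_mulDl galg_mulDr galg_one_neq0.

Fact galg_scaleAl (c : k) x y : c *: (x * y) = (c *: x) * y.
Proof.
apply/ffunP=> g; rewrite !ffunE scaler_sumr.
by apply: eq_bigr => h _; rewrite ffunE scalerAl.
Qed.

HB.instance Definition _ :=
  GRing.Lmodule_isLalgebra.Build k group_algebra galg_scaleAl.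

Fact galg_scaleAr (c : k) x y : c *: (x * y) = x * (c *: y).
Proof.
apply/ffunP=> g; rewrite !ffunE scaler_sumr.
by apply: eq_bigr => h _; rewrite ffunE scalerAr.
Qed.

HB.instance Definition _ :=
  GRing.Lalgebra_isAlgebra.Build k group_algebra galg_scaleAr.

HB.instance Definition _ := Algebra_isFalgebra.Build k group_algebra.

Definition galg_elt (g : G) : group_algebra := [ffun h => (h == g)%:R].

Lemma galg_elt1 : galg_elt 1%g = 1.
Proof. by []. Qed.

Lemma galg_eltM g h : galg_elt (g * h)%g = galg_elt g * galg_elt h.
Proof.
apply/ffunP=> u; rewrite !ffunE (bigD1 g) //= !ffunE eqxx mul1r big1 ?addr0.
  by rewrite (can2_eq (mulKVg g) (mulKg g)).
by move=> v /negPf vg; rewrite !ffunE vg mul0r.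
Qed.

Lemma galg_sumE x : x = \sum_g x g *: galg_elt g.
Proof.
apply/ffunP=> h; rewrite sum_ffunE (bigD1 h) //= !ffunE eqxx.
rewrite big1 ?addr0 => [|g /negPf gh]; first by rewrite [RHS]mulr1.
by rewrite !ffunE eq_sym gh; apply: mulr0.
Qed.

End GroupAlgebra.

(* Main.v *)
Require Import Defs.
From HB Require Import structures.
From mathcomp Require Import all_boot all_order all_fingroup all_solvable.
From mathcomp Require Import all_algebra all_field.
From mathcomp Require Import boolp zify.

Set Implicit Arguments.
Unset Strict Implicit.
Unset Printing Implicit Defensive.

Import GRing.Theory.
Local Open Scope ring_scope.

(** Write A = kG = k[x]/(x - 1)^5 and B = kH with y = h - 1 for a generator h
of H, so that y^b = 0 and y^(b-1) <> 0 for b = 5^n. When M is finitely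
generated projective over A, the algebra B cannot be a bimodule summand of
N (x)_A M, because b is a power of the characteristic larger than 5.

The contradiction lies in a trace. Let e be the central element of N (x)_A M
that splits off B, let pi be the projection onto B, and let lambda be a linear
form on B. The form (n, v) |-> lambda (pi (n (x) v)) lifts, because A is
symmetric, to A-linear maps f_n : M -> A whose coefficient at 1 it is. If
e = sum n_j (x) v_j, then W(u) = sum f_(n_j)(u) v_j is an A-linear
endomorphism of M; it commutes with y since e is central, and the coefficient
at 1 of the trace of W y^i over A is lambda (y^i). A dual basis of the
projective module M turns the actions of y and of W into commuting matrices
over A, with the same traces: this is bimod_summand_matrices.

On the other hand tr (Y^(b-1) W) = 0 for all commuting matrices Y, W over A
with Y^b = 0 (mxtrace_comm_expr_pred0), which forces y^(b-1) = 0 as lambda is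
arbitrary. For W = 1, lift Y to a matrix Z over k[x], so that
Z^b = (x - 1)^5 U. In characteristic p the trace commutes with p-th powers
(mxtrace_pchar_exp), hence tr(Z^(b-1))^b = tr((Z^b)^(b-1)) is divisible by
(x - 1)^(5(b-1)). Thus tr(Z^(b-1)) has valuation at least 5 - 5/b > 4 at
x = 1, and its image in A vanishes (mxtrace_expr_pred0). The same holds over
A[s], and there the matrix Y (1 + s W) also has b-th power 0; the coefficient
of s in the trace of its (b-1)-st power is (b-1) tr(Y^(b-1) W), where b - 1
is invertible in k. *)

(** * Traces and powers in characteristic p *)

Lemma det_exp (R : comNzRingType) m (X : 'M[R]_m) i :
  \det (X ^+ i) = \det X ^+ i.
Proof.
elim: i => [|i IHi]; first by rewrite !expr0 det1.
by rewrite !exprS det_mulmx IHi.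
Qed.

(** In characteristic p the p-th power of a polynomial is obtained by raising
the coefficients and the variable to the p-th power. *)
Lemma coef_pchar_exp (R : comNzRingType) p (P : {poly R}) i :
  p \in [pchar R] -> (P ^+ p)`_(p * i) = P`_i ^+ p.
Proof.
move=> pR; have p_gt0 := prime_gt0 (pcharf_prime pR).
have pRX : [pchar {poly R}].-nat p.
  by rewrite pnatE ?(pcharf_prime pR) // pchar_poly.
elim/poly_ind: P i => [|P c IHP] i.
  by rewrite expr0n gtn_eqF // !coef0 expr0n gtn_eqF.
rewrite exprDn_pchar // exprMn -polyC_exp !coefD coefMXn coefMX !coefC.
case: i => [|i]; first by rewrite muln0 p_gt0 !add0r.
rewrite mulnS ltnNge leq_addr /= addKn IHP gtn_eqF ?addr0 //.
by rewrite addn_gt0 p_gt0.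
Qed.

(** The matrices X and t I commute, so that det (t^p I - X^p) is the p-th power
of det (t I - X) in characteristic p; comparing the subleading coefficients
gives the claim for p-th powers. *)
Lemma mxtrace_pchar_exp (R : comNzRingType) p n m (X : 'M[R]_m) :
  p \in [pchar R] -> \tr (X ^+ (p ^ n)) = \tr X ^+ (p ^ n).
Proof.
move=> pR; have p_pr := pcharf_prime pR; have p_gt0 := prime_gt0 p_pr.
suff tr1 (Y : 'M[R]_m) : \tr (Y ^+ p) = \tr Y ^+ p.
  by elim: n => [|n IHn]; rewrite ?expr1 // expnSr !exprM tr1 IHn.
case: m X Y => [_|m _] Y.
  by rewrite /mxtrace !big_ord0 expr0n gtn_eqF.
have pP : p \in [pchar {poly R}] by rewrite pchar_poly.
have pM : p \in [pchar 'M[{poly R}]_m.+1].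
  rewrite inE p_pr -(rmorph_nat (@scalar_mx {poly R} m.+1)).
  by rewrite (pcharf0 pP) rmorph0 /=.
have charE : char_poly (Y ^+ p) \Po 'X^p = char_poly Y ^+ p.
  rewrite /char_poly -det_exp /char_poly_mx.
  have /(pFrobenius_autB_comm pM) : GRing.comm 'X%:M (map_mx polyC Y).
    by apply/comm_mx_sym; apply: comm_mx_scalar.
  rewrite !pFrobenius_autE => ->.
  rewrite -[_ \Po _]/(comp_poly _ _) -det_map_mx; congr (\det _).
  rewrite -!rmorphXn /= map_mxB map_scalar_mx /= comp_polyX; congr (_ - _).
  by apply/matrixP=> i j; rewrite !mxE comp_polyC.
have := congr1 (fun P : {poly R} => P`_(p * m)) charE.
rewrite /= coef_comp_poly_Xn // dvdn_mulr // mulKn //.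
rewrite (@char_poly_trace R m.+1) // coef_pchar_exp //.
rewrite (@char_poly_trace R m.+1) //.
by rewrite -!(pFrobenius_autE pR) pFrobenius_autN => /oppr_inj.
Qed.

(** * Nilpotent matrices over a truncated polynomial ring *)

Lemma polyC_dvd_coef (k : fieldType) (d : {poly k}) (c : {poly {poly k}}) :
  (forall i, d %| c`_i) -> exists c', c = d%:P * c'.
Proof.
move=> dc; exists (\poly_(i < size c) (c`_i %/ d)); apply/polyP=> i.
rewrite coefCM coef_poly; case: ltnP => [_|ci]; first by rewrite mulrC divpK.
by rewrite nth_default ?mulr0.
Qed.

(** The element x - t of k[x][s] is prime: the quotient is the domain k[s]. *)
Lemma polyC_prime_exp (k : fieldType) (t : k) (c d : {poly {poly k}}) b :
  c ^+ b = ('X - t%:P)%:P * d -> exists c', c = ('X - t%:P)%:P * c'.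
Proof.
move=> cd; apply: polyC_dvd_coef => i; rewrite dvdp_XsubCl.
have := congr1 (map_poly (horner_eval t)) cd.
rewrite rmorphXn rmorphM /= map_polyC /= [horner_eval _ ('X - _)]/horner_eval.
rewrite hornerXsubC subrr mul0r.
move/eqP; rewrite expf_eq0 => /andP[_ /eqP/polyP/(_ i)].
by rewrite coef_map coef0 => /eqP.
Qed.

(** A valuation argument: if b v(c) >= N > (a - 1) b, then v(c) >= a. *)
Lemma polyC_exp_dvd (k : fieldType) (t : k) (c d : {poly {poly k}}) a b N :
  (a.-1 * b < N)%N -> c ^+ b = ('X - t%:P)%:P ^+ N * d ->
  exists c', c = ('X - t%:P)%:P ^+ a * c'.
Proof.
set x := _%:P => aN cd; have x0 : x != 0 by rewrite polyC_eq0 polyXsubC_eq0.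
suff H j : (j <= a)%N -> exists c', c = x ^+ j * c' by apply: H.
elim: j => [_|j IHj ja]; first by exists c; rewrite mul1r.
have [c' cE] := IHj (ltnW ja).
have jN : (j * b < N)%N.
  apply: leq_ltn_trans aN; rewrite leq_mul2r -ltnS prednK ?ja ?orbT //.
  exact: leq_ltn_trans ja.
have [c'' c'E] : exists c'', c' = x * c''.
  apply: (@polyC_prime_exp _ t _ (x ^+ (N - (j * b).+1) * d) b).
  apply: (mulfI (expf_neq0 (j * b) x0)).
  rewrite exprM -exprMn -cE cd -/x -exprM mulrCA mulrA -exprS mulrA -exprD mulrC.
  by rewrite (subnKC jN) mulrC.
by exists c''; rewrite cE c'E mulrA exprSr.
Qed.

(** Here eps presents A as k[x]/(x - t)^a. With Z a lift of Y to k[x][s] and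
b = p^n, the trace of Z^(b-1) has a b-th power divisible by
(x - t)^(a (b - 1)), and a (b - 1) > (a - 1) b since a < b. *)
Lemma mxtrace_expr_pred0 (k : fieldType) (t : k) p n a (A : nzRingType)
    (eps : {rmorphism {poly k} -> A}) m (Y : 'M[{poly A}]_m) :
  p \in [pchar k] -> (0 < a < p ^ n)%N ->
  (forall c, exists P, eps P = c) ->
  (forall P, eps P = 0 <-> ('X - t%:P) ^+ a %| P) ->
  Y ^+ (p ^ n) = 0 -> \tr (Y ^+ (p ^ n).-1) = 0.
Proof.
move=> pk; set b := (p ^ n)%N => /andP[a0 ab] eps_surj eps_ker Yb0.
pose x : {poly {poly k}} := ('X - t%:P)%:P.
pose phi := map_poly eps.
have phi_surj y : exists P, phi P = y.
  have [s sK] := choice eps_surj.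
  exists (\poly_(i < size y) s y`_i); apply/polyP=> i.
  rewrite coef_map coef_poly /=; case: ltnP => [_|yi]; first exact: sK.
  by rewrite rmorph0 nth_default.
have phi_ker P : phi P = 0 <-> exists P', P = x ^+ a * P'.
  split=> [phiP|[P' ->]].
    rewrite -polyC_exp; apply: polyC_dvd_coef => i; apply/eps_ker.
    by rewrite -coef_map -/phi phiP coef0.
  rewrite /phi rmorphM -polyC_exp /= map_polyC /=.
  by have [_ ->] := eps_ker (('X - t%:P) ^+ a); rewrite ?mul0r ?dvdpp.
have [Z phiZ] : exists Z, map_mx phi Z = Y.
  have [s sK] := choice phi_surj.
  by exists (map_mx s Y); apply/matrixP=> i j; rewrite !mxE sK.
have phiX i : map_mx phi (Z ^+ i) = Y ^+ i.
  rewrite -phiZ; elim: i => [|i IHi]; rewrite ?expr0 ?map_mx1 //.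
  by rewrite !exprS map_mxM IHi.
have [U ZbE] : exists U, Z ^+ b = x ^+ a *: U.
  have /choice[u uE] (ij : 'I_m * 'I_m) :
      exists u, (Z ^+ b) ij.1 ij.2 = x ^+ a * u.
    by apply/phi_ker; have /matrixP/(_ ij.1 ij.2) := phiX b; rewrite Yb0 !mxE.
  exists (\matrix_(i, j) u (i, j)); apply/matrixP=> i j.
  by rewrite !mxE (uE (i, j)).
rewrite -phiX trace_map_mx /=; apply/phi_ker.
apply: (@polyC_exp_dvd _ t _ (\tr (U ^+ b.-1)) a b (a * b.-1)).
  by clear -a0 ab; nia.
rewrite -mxtrace_pchar_exp ?pchar_poly // -exprM mulnC exprM ZbE.
have -> : (x ^+ a *: U) ^+ b.-1 = (x ^+ a) ^+ b.-1 *: U ^+ b.-1.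
  elim: b.-1 => [|i IHi]; first by rewrite !expr0 scale1r.
  by rewrite !exprS IHi -[_ * _]/(_ *m _) -scalemxAl -scalemxAr scalerA.
by rewrite mxtraceZ -exprM.
Qed.

(** The next two facts are the product rule for matrices modulo s^2. *)
Lemma coefp0_mulmx (A : nzRingType) m (P Q : 'M[{poly A}]_m) :
  map_mx (coefp 0) (P * Q) = map_mx (coefp 0) P * map_mx (coefp 0) Q.
Proof.
apply/matrixP=> i j; rewrite !mxE /= coef_sum; apply: eq_bigr => l _.
by rewrite !mxE /= coefM big_ord1.
Qed.

Lemma coefp1_mulmx (A : nzRingType) m (P Q : 'M[{poly A}]_m) :
  map_mx (coefp 1) (P * Q) = map_mx (coefp 0) P * map_mx (coefp 1) Q
                           + map_mx (coefp 1) P * map_mx (coefp 0) Q.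
Proof.
apply/matrixP=> i j; rewrite !mxE /= coef_sum -big_split; apply: eq_bigr => l _.
by rewrite !mxE /= coefM !big_ord_recl big_ord0 addr0.
Qed.

(** Deform Y to Y (1 + s W), whose b-th power is still 0 because Y and W
commute, and read off the coefficient of s in the trace of the (b-1)-st
power. *)
Lemma mxtrace_comm_expr_pred0 (k : fieldType) (t : k) p n a (A : nzRingType)
    (eps : {rmorphism {poly k} -> A}) m (Y W : 'M[A]_m) :
  p \in [pchar k] -> (0 < a < p ^ n)%N ->
  (forall c, exists P, eps P = c) ->
  (forall P, eps P = 0 <-> ('X - t%:P) ^+ a %| P) ->
  GRing.comm Y W -> Y ^+ (p ^ n) = 0 -> \tr (Y ^+ (p ^ n).-1 * W) = 0.
Proof.
move=> pk an eps_surj eps_ker YW Yb0; set b := (p ^ n)%N.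
pose C (U : 'M[A]_m) : 'M[{poly A}]_m := map_mx polyC U.
pose T := 1 + C W * 'X%:M.
have CX U i : C U ^+ i = C (U ^+ i).
  elim: i => [|i IHi]; first by rewrite /C !expr0 map_mx1.
  by rewrite !exprS IHi /C map_mxM.
have YT : GRing.comm (C Y) T.
  apply: commrD; first exact: commr1.
  apply: commrM; first by have := congr1 C YW; rewrite /C !map_mxM.
  rewrite /GRing.comm -[_ * _]/(_ *m _) -[RHS]/(_ *m _) mul_scalar_mx.
  apply/matrixP=> i j; rewrite !mxE (bigD1 j) //= big1 => [|l lj].
    by rewrite !mxE eqxx mulr1n addr0 commr_polyX.
  by rewrite !mxE (negPf lj) mulr0n mulr0.
have C0 U : map_mx (coefp 0) (C U) = U.
  by apply/matrixP=> i j; rewrite !mxE /= coefC.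
have C1 U : map_mx (coefp 1) (C U) = 0.
  by apply/matrixP=> i j; rewrite !mxE /= coefC.
have X0 : map_mx (coefp 0) ('X%:M : 'M[{poly A}]_m) = 0.
  by apply/matrixP=> i j; rewrite !mxE /= coefMn coefX mul0rn.
have X1 : map_mx (coefp 1) ('X%:M : 'M[{poly A}]_m) = 1.
  by apply/matrixP=> i j; rewrite !mxE /= coefMn coefX.
have one0 : map_mx (coefp 0) (1 : 'M[{poly A}]_m) = 1.
  by have := C0 1; rewrite /C [map_mx polyC _]map_mx1.
have one1 : map_mx (coefp 1) (1 : 'M[{poly A}]_m) = 0.
  by have := C1 1; rewrite /C [map_mx polyC _]map_mx1.
have T0 : map_mx (coefp 0) T = 1.
  by rewrite map_mxD coefp0_mulmx X0 mulr0 one0 addr0.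
have T1 : map_mx (coefp 1) T = W.
  by rewrite map_mxD coefp1_mulmx X1 C0 C1 one1 mulr1 mul0r addr0 add0r.
have TX0 i : map_mx (coefp 0) (T ^+ i) = 1.
  elim: i => [|i IHi]; first by rewrite expr0 one0.
  by rewrite exprS coefp0_mulmx T0 IHi mulr1.
have TX1 i : map_mx (coefp 1) (T ^+ i) = W *+ i.
  elim: i => [|i IHi]; first by rewrite expr0 one1.
  by rewrite exprS coefp1_mulmx T0 T1 TX0 IHi mul1r mulr1 mulrSr.
have /(congr1 (coefp 1)) : \tr ((C Y * T) ^+ b.-1) = 0.
  apply: (mxtrace_expr_pred0 pk an eps_surj eps_ker).
  by rewrite exprMn_comm // CX Yb0 [C 0](_ : _ = 0) ?mul0r // /C map_mx0.
have trC (U : 'M[{poly A}]_m) : coefp 1 (\tr U) = \tr (map_mx (coefp 1) U).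
  by rewrite /mxtrace raddf_sum; apply: eq_bigr => i _; rewrite mxE.
rewrite trC exprMn_comm // CX coefp1_mulmx C0 C1 mul0r addr0 TX1 /= coef0.
rewrite mulrnAr raddfMn /=.
have b_gt1 : (1 < b)%N by case/andP: an; apply: leq_ltn_trans.
have b0 : b%:R = 0 :> A.
  have pA : p%:R = 0 :> A.
    by rewrite -(rmorph_nat eps) (@pcharf0 {poly k} p) ?rmorph0 // pchar_poly.
  by rewrite natrX pA expr0n; move: b_gt1; rewrite /b; case: (n).
(* Since b is 0 in A, the factor b - 1 is invertible. *)
move=> tr0; rewrite -[LHS]addr0 -[X in _ + X]tr0 -mulrS prednK ?(ltnW b_gt1) //.
by rewrite -mulr_natr b0 mulr0.
Qed.


(** * The group algebra of a cyclic p-group *)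

Lemma subr1_exp_pchar (R : comNzRingType) q (x : R) :
  [pchar R].-nat q -> (x - 1) ^+ q = x ^+ q - 1.
Proof.
move=> qR; rewrite exprDn_pchar //; congr (_ + _).
apply/eqP; rewrite -subr_eq0 opprK -{2}(expr1n R q) -exprDn_pchar // addNr.
by rewrite expr0n gtn_eqF //; case/andP: qR.
Qed.

Section CyclicGroupAlgebra.
Variables (k : fieldType) (K : finGroupType) (h : K).
Hypothesis hK : [set: K] = <[h]>%g.

Local Notation eps := (horner_alg (galg_elt k h)).

Lemma galg_eltX i : galg_elt k (h ^+ i)%g = galg_elt k h ^+ i.
Proof.
by elim: i => [|i IHi]; rewrite ?expg0 ?galg_elt1 // expgS galg_eltM IHi exprS.
Qed.

(** The powers of h with exponent below the order of the group are distinct, so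
a polynomial of that size can be read off from its value at h. *)
Lemma galg_horner_coef (P : {poly k}) j :
  (size P <= #|K|)%N -> (j < #|K|)%N -> eps P (h ^+ j)%g = P`_j.
Proof.
have oh : #[h]%g = #|K| by rewrite orderE -hK cardsT.
move=> sP jK; rewrite -{1}[P]coefK poly_def linear_sum /= sum_ffunE.
have E i : eps (P`_i *: 'X^i) (h ^+ j)%g = P`_i * (h ^+ j == h ^+ i)%g%:R.
  by rewrite linearZ /= rmorphXn /= horner_algX -galg_eltX mulr_algl !ffunE.
under eq_bigr do rewrite E.
case: (ltnP j (size P)) => [jP|jP].
  rewrite (bigD1 (Ordinal jP)) //= eqxx mulr1 big1 ?addr0 // => i ij.
  rewrite eq_expg_mod_order oh !modn_small ?(leq_trans (ltn_ord i) sP) //.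
  by rewrite eq_sym -val_eqE /= in ij *; rewrite (negPf ij) mulr0.
rewrite nth_default // big1 // => i _.
rewrite eq_expg_mod_order oh !modn_small ?(leq_trans (ltn_ord i) sP) //.
by rewrite gtn_eqF ?mulr0 // (leq_trans (ltn_ord i) jP).
Qed.

Lemma galg_horner_surj c : exists P, eps P = c.
Proof.
have /choice[f fE] (g : K) : exists i, g = (h ^+ i)%g.
  by apply/cycleP; rewrite -hK inE.
exists (\sum_g c g *: 'X^(f g)); rewrite [RHS]galg_sumE linear_sum /=.
apply: eq_bigr => g _.
by rewrite linearZ /= rmorphXn /= horner_algX -galg_eltX -fE mulr_algl.
Qed.

Lemma galg_horner_ker P :
  [pchar k].-nat #|K| -> eps P = 0 <-> ('X - 1%:P) ^+ #|K| %| P.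
Proof.
move=> pK; have K0 : (0 < #|K|)%N by case/andP: pK.
have E : ('X - 1%:P) ^+ #|K| = 'X^#|K| - 1 :> {poly k}.
  by apply: subr1_exp_pchar; rewrite (eq_pnat _ (pchar_poly k)).
have epsE : eps ('X^#|K| - 1) = 0.
  rewrite rmorphB rmorph1 rmorphXn /= horner_algX -galg_eltX.
  by rewrite -cardsT expg_cardG ?inE // subrr.
rewrite E; split=> [|/dvdpP[Q ->]]; last by rewrite rmorphM /= epsE mulr0.
rewrite {1}(divp_eq P ('X^#|K| - 1)) rmorphD rmorphM /= epsE mulr0 add0r => eR.
have sR : (size (P %% ('X^#|K| - 1))%R <= #|K|)%N.
  by rewrite -ltnS -(size_XnsubC (1 : k) K0) ltn_modp -size_poly_gt0 size_XnsubC.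
apply/eqP/polyP=> j; rewrite coef0; case: (ltnP j #|K|) => jK.
  by rewrite -galg_horner_coef // eR ffunE.
by rewrite nth_default ?(leq_trans sR).
Qed.

Lemma cyclic_galg_mulC (c c' : group_algebra k K) : c * c' = c' * c.
Proof.
have [P <-] := galg_horner_surj c; have [P' <-] := galg_horner_surj c'.
by rewrite -!rmorphM mulrC.
Qed.

Lemma galg_sub1_expr_eq0 i : [pchar k].-nat #|K| ->
  ((galg_elt k h - 1) ^+ i == 0) = (#|K| <= i)%N.
Proof.
move=> pK; have -> : galg_elt k h - 1 = eps ('X - 1%:P).
  by rewrite rmorphB /= horner_algX horner_algC scale1r.
rewrite -rmorphXn; apply/eqP/idP=> [/(galg_horner_ker _ pK)|iK].
  move=> /dvdp_leq; rewrite !size_exp_XsubC.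
  by rewrite expf_neq0 ?polyXsubC_eq0 ?ltnS //; apply.
by apply/(galg_horner_ker _ pK); apply: dvdp_exp2l.
Qed.

End CyclicGroupAlgebra.

(** * Dual bases and traces *)

Section DualBasis.
Variables (R : nzRingType) (V : lmodType R).

Section Combination.
Variables (m : nat) (e : 'I_m -> V).

Definition lin_comb (c : 'rV[R]_m) : V := \sum_j c 0 j *: e j.

Fact lin_comb_linear : linear lin_comb.
Proof.
move=> a c c'; rewrite /lin_comb scaler_sumr -big_split; apply: eq_bigr => j _ /=.
by rewrite !mxE scalerDl scalerA.
Qed.

HB.instance Definition _ :=
  GRing.isLinear.Build R 'rV[R]_m V _ lin_comb lin_comb_linear.

End Combination.

Lemma fg_projective_dual_basis : fg_projective V ->
  exists m (e : 'I_m -> V) (d : {linear V -> 'rV[R]_m}),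
    forall v, \sum_j d v 0 j *: e j = v.
Proof.
case=> -[m [e eP]] projV.
have [y|d dP] := projV 'rV[R]_m V (lin_comb e) idfun.
  by have [c ->] := eP y; exists (\row_j c j); apply: eq_bigr => j _; rewrite mxE.
by exists m, e, d.
Qed.

Variables (m : nat) (e : 'I_m -> V) (d : {linear V -> 'rV[R]_m}).
Hypothesis dual : forall v, \sum_j d v 0 j *: e j = v.

Definition endo_mx (phi : V -> V) : 'M[R]_m := \matrix_(i, j) d (phi (e i)) 0 j.

(** Vectors are rows, so composition is reversed. The matrices describe the
endomorphisms of V extended by 0 to a free module containing V as a summand;
the identity of V may become a proper idempotent. *)
Lemma endo_mxM (phi : V -> V) (psi : {linear V -> V}) :
  endo_mx phi * endo_mx psi = endo_mx (psi \o phi).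
Proof.
apply/matrixP=> i j; rewrite !mxE /= -[in RHS](dual (phi (e i))) !linear_sum summxE.
by apply: eq_bigr => l _; rewrite !mxE !linearZ mxE.
Qed.

Lemma eq_endo_mx (phi psi : V -> V) : phi =1 psi -> endo_mx phi = endo_mx psi.
Proof. by move=> E; apply/matrixP=> i j; rewrite !mxE E. Qed.

End DualBasis.

(** * Bimodule summands *)

Section BimoduleScaling.
Variables (k : fieldType) (A B : algType k) (M : bimodule A B).
Implicit Types (a : A) (b : B) (u v : M).

Lemma lscale0 a : lscale a (0 : M) = 0.
Proof. exact: (@scaler0 A (left_module M)). Qed.

Lemma rscale0 b : rscale (0 : M) b = 0.
Proof. exact: (@scaler0 B^c (right_module M)). Qed.

Lemma lscaleB a u v : lscale a (u - v) = lscale a u - lscale a v.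
Proof. exact: (@scalerBr A (left_module M)). Qed.

Lemma rscaleB u v b : rscale (u - v) b = rscale u b - rscale v b.
Proof. exact: (@scalerBr B^c (right_module M)). Qed.

Definition right_mul b (u : left_module M) : left_module M := rscale (u : M) b.

Fact right_mul_linear b : linear (right_mul b).
Proof.
by move=> a u u'; rewrite /right_mul rscaleDl; congr (_ + _); rewrite -lrscale.
Qed.

HB.instance Definition _ b :=
  GRing.isLinear.Build A (left_module M) (left_module M) _
    (right_mul b) (right_mul_linear b).

End BimoduleScaling.

Section BimoduleSplitting.
Variables (k : fieldType) (A B : algType k).
Variables (N : bimodule B A) (M : bimodule A B) (Y : bimodule B B).
Local Notation T := (tensor_bimod N M).

(** The element x0 is the image of 1; it is central because 1 is. *)
Lemma regular_summand_splitting :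
  bimod_iso T (dsum_bimod (regular_bimod B) Y) ->
  exists (pi : {additive T -> B}) (x0 : T),
    [/\ pi x0 = 1, forall b, lscale b x0 = rscale x0 b,
        forall b x, pi (lscale b x) = b * pi x
      & forall x b, pi (rscale x b) = pi x * b].
Proof.
case=> f [[g fK gK] fl fr].
exists (fst \o f : {additive T -> B}), (g (1, 0)); split=> [|b|b x|x b] /=.
- by rewrite gK.
- apply: (can_inj fK); rewrite fl fr !gK /= lscale0 rscale0.
  by rewrite /lscale /rscale /= mulr1 mul1r.
- by rewrite fl.
- by rewrite fr.
Qed.

End BimoduleSplitting.

(** * From a tensor product to commuting matrices *)

Section Transfer.
Variables (k : fieldType) (G : finGroupType) (B : algType k).
Local Notation A := (group_algebra k G).
Variables (N : bimodule B A) (M : bimodule A B).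
Local Notation T := (tensor_bimod N M).
Local Notation L := (left_module M).

Hypothesis mulAC : forall a a' : A, a * a' = a' * a.
Hypothesis mulBC : forall b b' : B, b * b' = b' * b.
Variables (lambda : {linear B -> k^o}) (pi : {additive T -> B}).
Hypothesis pi_l : forall b x, pi (lscale b x) = b * pi x.
Hypothesis pi_r : forall x b, pi (rscale x b) = pi x * b.

Definition pairing (n : N) (v : M) : k := lambda (pi (tens n v)).

Lemma pairingDl n n' v : pairing (n + n') v = pairing n v + pairing n' v.
Proof. by rewrite /pairing tensDl !raddfD. Qed.

Lemma pairingDr n v v' : pairing n (v + v') = pairing n v + pairing n v'.
Proof. by rewrite /pairing tensDr !raddfD. Qed.

Lemma pairing_balanced n a v : pairing (rscale n a) v = pairing n (lscale a v).
Proof. by rewrite /pairing tens_balanced. Qed.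

Lemma pairing_outer b n v : pairing (lscale b n) v = pairing n (rscale v b).
Proof.
have pl : pi (tens (lscale b n) v) = b * pi (tens n v).
  by rewrite -pi_l /lscale /= tens_lscaleE.
have pr : pi (tens n (rscale v b)) = pi (tens n v) * b.
  by rewrite -pi_r /rscale /= tens_rscaleE.
by rewrite /pairing pl pr mulBC.
Qed.

Lemma pairingZr n (c : k) (v : M) : pairing n (lscale c%:A v) = c * pairing n v.
Proof.
have pr : pi (tens n (rscale v c%:A)) = pi (tens n v) * c%:A.
  by rewrite -pi_r /rscale /= tens_rscaleE.
by rewrite /pairing bimod_central pr mulr_algr linearZ.
Qed.

(** Coefficientwise form of the isomorphism between k-linear forms on an
A-module and A-linear maps to A that comes from the symmetrizing form of the
group algebra, the coefficient at 1. *)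
Definition pairing_lift (n : N) (v : L) : A :=
  [ffun g => pairing n (lscale (galg_elt k g^-1%g) v)].

Lemma pairing_liftDl n n' v :
  pairing_lift (n + n') v = pairing_lift n v + pairing_lift n' v.
Proof. by apply/ffunP=> g; rewrite !ffunE pairingDl. Qed.

Lemma pairing_lift_is_linear n : linear (pairing_lift n : L -> A^o).
Proof.
have pD (I : finType) (F : I -> M) :
    pairing n (\sum_i F i) = \sum_i pairing n (F i).
  have p0 : pairing n 0 = 0.
    by apply: (addrI (pairing n 0)); rewrite -pairingDr !addr0.
  exact: (big_morph _ (pairingDr n) p0).
move=> a v v'; apply/ffunP=> g; rewrite !ffunE lscaleDr pairingDr; congr (_ + _).
rewrite -[a *: v]/(lscale a (v : M)) -lscaleM [X in _ * X]galg_sumE mulr_sumr.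
rewrite -[lscale _ v]/(_ *: v) scaler_suml [LHS]pD; apply: eq_bigr => h _.
rewrite ffunE invMg invgK galg_eltM -[_ *: v]/(lscale _ (v : M)).
rewrite -scalerAr -mulr_algl.
by rewrite lscaleM pairingZr.
Qed.
HB.instance Definition _ n :=
  GRing.isLinear.Build A L A^o _ (pairing_lift n) (@pairing_lift_is_linear n).

Lemma pairing_lift_balanced n a v :
  pairing_lift (rscale n a) v = pairing_lift n v * a.
Proof.
rewrite mulAC -[RHS](linearZ_LR (pairing_lift n)); apply/ffunP=> g.
by rewrite !ffunE pairing_balanced -!lscaleM mulAC.
Qed.

Lemma pairing_lift_outer b n v :
  pairing_lift (lscale b n) v = pairing_lift n (right_mul b v).
Proof. by apply/ffunP=> g; rewrite !ffunE pairing_outer lrscale. Qed.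

(** An element of N (x)_A M acts on M because each n in N is a linear form on
M. *)
Definition tensor_endo (x : T) (u : L) : L :=
  tens_lift (fun n v => pairing_lift n u *: (v : L)) x.

Fact tensor_endo_bal u : balanced (fun n (v : M) => pairing_lift n u *: (v : L)).
Proof.
split=> [n n' v|n v v'|n a v]; first by rewrite pairing_liftDl scalerDl.
- exact: scalerDr.
- by rewrite pairing_lift_balanced -scalerA.
Qed.

Lemma tensor_endoE n v u : tensor_endo (tens n v) u = pairing_lift n u *: (v : L).
Proof. exact/tens_liftE/tensor_endo_bal. Qed.

Lemma tensor_endoB u : zmod_morphism (tensor_endo^~ u).
Proof. exact/tens_liftB/tensor_endo_bal. Qed.

Lemma tensor_endo_is_linear x : linear (tensor_endo x).
Proof.
move=> a u u'; elim/tensor_ind: x => [|x y IHx IHy|n v].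
- by rewrite -(subrr 0) !tensor_endoB !subrr scaler0 addr0.
- by rewrite !tensor_endoB IHx IHy scalerBr opprD addrACA.
- by rewrite !tensor_endoE linearP scalerDl scalerA.
Qed.

HB.instance Definition _ x :=
  GRing.isLinear.Build A L L _ (tensor_endo x) (@tensor_endo_is_linear x).

Lemma tensor_endo_lscale b x u :
  tensor_endo (lscale b x) u = tensor_endo x (right_mul b u).
Proof.
elim/tensor_ind: x => [|x y IHx IHy|n v].
- by rewrite lscale0 -(subrr 0) !tensor_endoB !subrr.
- by rewrite lscaleB !tensor_endoB IHx IHy.
- by rewrite {1}/lscale /= tens_lscaleE !tensor_endoE pairing_lift_outer.
Qed.

Lemma tensor_endo_rscale x b u :
  tensor_endo (rscale x b) u = right_mul b (tensor_endo x u).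
Proof.
elim/tensor_ind: x => [|x y IHx IHy|n v].
- by rewrite rscale0 -(subrr 0) !tensor_endoB !subrr linear0.
- by rewrite rscaleB !tensor_endoB IHx IHy linearB.
- by rewrite {1}/rscale /= tens_rscaleE !tensor_endoE; apply: lrscale.
Qed.

Variables (m : nat) (e : 'I_m -> L) (d : {linear L -> 'rV[A]_m}).
Hypothesis dual : forall v, \sum_j d v 0 j *: e j = v.

(** The endomorphism given by n (x) v has rank one, so its trace is the value
at v of the linear form of n. *)
Lemma mxtrace_tensor_endo x b :
  (\tr (endo_mx e d (tensor_endo x \o right_mul b))) 1%g
    = lambda (pi (rscale x b)).
Proof.
have trE : \tr (endo_mx e d (tensor_endo x \o right_mul b))
         = \sum_i d (tensor_endo x (right_mul b (e i))) 0 i.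
  by apply: eq_bigr => i _; rewrite mxE.
rewrite {}trE; elim/tensor_ind: x => [|x y IHx IHy|n v].
- rewrite rscale0 !raddf0 big1 ?ffunE // => i _.
  by rewrite -(subrr 0) tensor_endoB !subrr linear0 mxE.
- rewrite rscaleB !raddfB /= -IHx -IHy -[LHS]/((_ : {ffun G -> k^o}) _).
  under eq_bigr do rewrite tensor_endoB linearB mxE mxE.
  by rewrite big_split /= sumrN !ffunE.
- have -> : \sum_i d (tensor_endo (tens n v) (right_mul b (e i))) 0 i
          = pairing_lift n (right_mul b v).
    rewrite -[in RHS](dual v).
    rewrite !linear_sum; apply: eq_bigr => i _.
    by rewrite tensor_endoE !linearZ mxE mulAC.
  rewrite ffunE invg1 galg_elt1 lscale1 /pairing.
  by rewrite {1}/rscale /= tens_rscaleE.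
Qed.

End Transfer.

(** The powers of y have positive exponent, as the matrix of y ^+ 0 is only an
idempotent. *)
Lemma bimod_summand_matrices (k : fieldType) (G : finGroupType) (B : algType k)
    (N : bimodule B (group_algebra k G)) (M : bimodule (group_algebra k G) B)
    (Y : bimodule B B) (lambda : {linear B -> k^o}) (y : B) :
  (forall a a' : group_algebra k G, a * a' = a' * a) ->
  (forall b b' : B, b * b' = b' * b) ->
  fg_projective (left_module M) ->
  bimod_iso (tensor_bimod N M) (dsum_bimod (regular_bimod B) Y) ->
  exists m (P W : 'M[group_algebra k G]_m),
    [/\ GRing.comm P W, forall i, y ^+ i.+1 = 0 -> P ^+ i.+1 = 0
      & forall i, (\tr (P ^+ i.+1 * W)) 1%g = lambda (y ^+ i.+1)].
Proof.
move=> mulAC mulBC /fg_projective_dual_basis[m [e [d dual]]].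
case/regular_summand_splitting=> pi [x0 [pi_x0 x0_central pi_l pi_r]].
pose W := endo_mx e d (tensor_endo lambda pi x0).
have PX i : endo_mx e d (right_mul y) ^+ i.+1 = endo_mx e d (right_mul (y ^+ i.+1)).
  elim: i => [|i IHi]; first by rewrite !expr1.
  rewrite exprS IHi endo_mxM //; apply: eq_endo_mx => u /=.
  by rewrite /right_mul -rscaleM -exprS.
exists m, (endo_mx e d (right_mul y)), W; split=> [|i yi0|i].
- rewrite /GRing.comm /W !endo_mxM //; apply: eq_endo_mx => u /=.
  rewrite -tensor_endo_lscale // x0_central.
  exact: tensor_endo_rscale.
- rewrite PX yi0; apply/matrixP=> i' j'; rewrite !mxE.
  have -> : right_mul 0 (e i') = 0.
    by apply: (addrI (rscale (e i' : M) 0)); rewrite -rscaleDr !addr0.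
  by rewrite linear0 mxE.
- by rewrite PX /W endo_mxM // mxtrace_tensor_endo // pi_r pi_x0 mul1r.
Qed.

Definition galg_coef (k : fieldType) (K : finGroupType) (g : K)
  (c : group_algebra k K) : k^o := c g.

Fact galg_coef_linear (k : fieldType) (K : finGroupType) (g : K) :
  linear (@galg_coef k K g).
Proof. by move=> t c c'; rewrite /galg_coef !ffunE. Qed.

HB.instance Definition _ (k : fieldType) (K : finGroupType) (g : K) :=
  GRing.isLinear.Build k (group_algebra k K) k^o _ (@galg_coef k K g)
    (@galg_coef_linear k K g).

Theorem mainTheorem11 (k : fieldType) (n : nat) (G H : finGroupType) :
  5%N \in [pchar k] -> (1 < n)%N ->
  cyclic [set: G] -> #|G| = 5%N ->
  cyclic [set: H] -> #|H| = (5 ^ n)%N ->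
  ~ separably_equivalent (group_algebra k G) (group_algebra k H).
Proof.
move=> p5 n_gt1 /cyclicP[g Gg] cardG /cyclicP[h Hh] cardH.
case=> M [N [[projM _] _ _ [Y isoY]]].
have nat5 i : [pchar k].-nat (5 ^ i)%N by rewrite pnatX pnatE // p5.
have pG : [pchar k].-nat #|G| by rewrite cardG -(expn1 5).
have pH : [pchar k].-nat #|H| by rewrite cardH.
have b_gt5 : (5 < 5 ^ n)%N by rewrite -{1}(expn1 5) ltn_exp2l.
pose y := galg_elt k h - 1.
have : y ^+ (5 ^ n).-1 != 0.
  by rewrite galg_sub1_expr_eq0 // cardH -ltnNge prednK // expn_gt0.
case/eqP; apply/ffunP=> u; rewrite [RHS]ffunE.
have [m [P [W [PW P0 trPW]]]] := bimod_summand_matrices (galg_coef u) y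
  (cyclic_galg_mulC Gg) (cyclic_galg_mulC Hh) projM isoY.
have b1 : (5 ^ n).-1 = (5 ^ n).-2.+1 by case: (5 ^ n)%N b_gt5 => [|[]].
have Pb0 : P ^+ (5 ^ n) = 0.
  rewrite -(ltn_predK b_gt5); apply: P0; rewrite (ltn_predK b_gt5).
  by apply/eqP; rewrite galg_sub1_expr_eq0 // cardH.
rewrite -[LHS]/(galg_coef u _) b1 -trPW -b1.
rewrite (mxtrace_comm_expr_pred0 (t := 1) (a := 5) p5 _
  (@galg_horner_surj k G g Gg) _ PW Pb0) ?ffunE //.
by move=> Q; rewrite -cardG; apply: galg_horner_ker.
Qed.
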